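(* Let $p_l(z)=z^m+q_{m-1}z^{m-1}+\dots+q_1z+q_0$ be a simple monic polynomial over $\mathbb{H}$ of degree $m$ with $q_0\ne0$. Then every zero $\tilde z\in\mathbb{H}$ of $p_l(z)$ satisfies, for every $\gamma\in[0,1]$, $$\left(\max_{1\le i\le m}\left(r_i'(C_{q_l})^{\gamma}\,c_i'(C_{q_l})^{1-\gamma}\right)\right)^{-1}\le|\tilde z|\le\max_{1\le i\le m}\left(r_i'(C_{p_l})^{\gamma}\,c_i'(C_{p_l})^{1-\gamma}\right).$$
   Context: $\mathbb{H}$ is the skew field of real quaternions with its usual modulus $|\cdot|$. A simple monic polynomial $p_l$ is $p_l(z)=z^m+\sum_{j=0}^{m-1}q_jz^j$ with $q_j\in\mathbb{H}$ (coefficients on the left), evaluated at $z\in\mathbb{H}$. For a monic polynomial $z^m+\sum_{j=0}^{m-1}b_jz^j$ with left coefficients, its companion matrix is the $m\times m$ matrix with ones in positions $(i,i+1)$, $1\le i\le m-1$, last row $(-b_0,-b_1,\dots,-b_{m-1})$, and zeros elsewhere. $C_{p_l}$ is the companion matrix of $p_l$. The reversal polynomial of $p_l$ is $q_l(z):=z^m+q_0^{-1}q_1z^{m-1}+\dots+q_0^{-1}q_{m-1}z+q_0^{-1}$, and $C_{q_l}$ is its companion matrix. For $A=(a_{ij})\in M_m(\mathbb{H})$, $r_i'(A):=\sum_{j=1}^m|a_{ij}|$ and $c_i'(A):=\sum_{j=1}^m|a_{ji}|$ are the full absolute row and column sums. *)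

(* Defs.v *)
From HB Require Import structures.
From mathcomp Require Import all_boot all_order all_algebra.
From mathcomp Require Import all_classical all_reals all_analysis.
From mathcomp Require Import ring lra.

Set Implicit Arguments.
Unset Strict Implicit.
Unset Printing Implicit Defensive.

Import Order.TTheory GRing.Theory Num.Theory.
Local Open Scope ring_scope.

(* [Quat a b c d] is the quaternion a + b i + c j + d k. *)
Record quat (R : Type) := Quat { qre : R; qi : R; qj : R; qk : R }.

Section QuatChoice.
Variable R : Type.

Definition quat_tuple (x : quat R) := (qre x, qi x, qj x, qk x).
Definition tuple_quat (t : R * R * R * R) :=
  Quat t.1.1.1 t.1.1.2 t.1.2 t.2.

Lemma quat_tupleK : cancel quat_tuple tuple_quat.
Proof. by case. Qed.

End QuatChoice.

HB.instance Definition _ (R : choiceType) :=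
  Choice.copy (quat R) (can_type (@quat_tupleK R)).

Section QuatRing.
Variable R : realFieldType.
Implicit Types x y z : quat R.

Definition quat_add x y :=
  Quat (qre x + qre y) (qi x + qi y) (qj x + qj y) (qk x + qk y).
Definition quat_opp x := Quat (- qre x) (- qi x) (- qj x) (- qk x).

Lemma quat_addA : associative quat_add.
Proof. by move=> x y z; congr Quat; rewrite /= addrA. Qed.
Lemma quat_addC : commutative quat_add.
Proof. by move=> x y; congr Quat; rewrite addrC. Qed.
Lemma quat_add0 : left_id (Quat 0 0 0 0) quat_add.
Proof. by case=> a b c d; congr Quat; rewrite add0r. Qed.
Lemma quat_addN : left_inverse (Quat 0 0 0 0) quat_opp quat_add.
Proof. by move=> x; congr Quat; rewrite addNr. Qed.

HB.instance Definition _ := GRing.isZmodule.Build (quat R) quat_addA quat_addC quat_add0 quat_addN.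

Definition quat_mul x y :=
  Quat (qre x * qre y - qi x * qi y - qj x * qj y - qk x * qk y)
       (qre x * qi y + qi x * qre y + qj x * qk y - qk x * qj y)
       (qre x * qj y - qi x * qk y + qj x * qre y + qk x * qi y)
       (qre x * qk y + qi x * qj y - qj x * qi y + qk x * qre y).

Lemma quat_mulA : associative quat_mul.
Proof. by move=> x y z; congr Quat => /=; ring. Qed.
Lemma quat_mul1l : left_id (Quat 1 0 0 0) quat_mul.
Proof. by case=> a b c d; congr Quat => /=; ring. Qed.
Lemma quat_mul1r : right_id (Quat 1 0 0 0) quat_mul.
Proof. by case=> a b c d; congr Quat => /=; ring. Qed.
Lemma quat_mulDl : left_distributive quat_mul +%R.
Proof. by move=> x y z; congr Quat => /=; ring. Qed.
Lemma quat_mulDr : right_distributive quat_mul +%R.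
Proof. by move=> x y z; congr Quat => /=; ring. Qed.
Lemma quat_one_neq0 : Quat 1 0 0 0 != 0 :> quat R.
Proof. by apply/eqP; case=> /eqP; rewrite oner_eq0. Qed.

HB.instance Definition _ := GRing.Zmodule_isNzRing.Build (quat R)
  quat_mulA quat_mul1l quat_mul1r quat_mulDl quat_mulDr quat_one_neq0.

Definition qsqnorm x := qre x ^+ 2 + qi x ^+ 2 + qj x ^+ 2 + qk x ^+ 2.

Lemma qsqnorm_eq0 x : (qsqnorm x == 0) = (x == 0).
Proof.
rewrite /qsqnorm !paddr_eq0 ?addr_ge0 ?sqr_ge0// !sqrf_eq0.
case: x => a b c d; apply/idP/eqP => /=.
  by case/andP=> /andP[/andP[/eqP-> /eqP->] /eqP->] /eqP->.
by case=> -> -> -> ->; rewrite eqxx.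
Qed.

(* The conjugate divided by the squared modulus; it sends 0 to 0. *)
Definition quat_inv x :=
  Quat (qre x / qsqnorm x) (- qi x / qsqnorm x)
       (- qj x / qsqnorm x) (- qk x / qsqnorm x).

Definition quat_unit : pred (quat R) := [pred x | x != 0].

Lemma quat_mulVl : {in quat_unit, left_inverse 1 quat_inv *%R}.
Proof.
move=> x; rewrite inE -qsqnorm_eq0 => nx.
by congr Quat => /=; move: nx; rewrite /qsqnorm => nx; field.
Qed.
Lemma quat_mulVr : {in quat_unit, right_inverse 1 quat_inv *%R}.
Proof.
move=> x; rewrite inE -qsqnorm_eq0 => nx.
by congr Quat => /=; move: nx; rewrite /qsqnorm => nx; field.
Qed.
Lemma quat_unitP x y : y * x = 1 /\ x * y = 1 -> quat_unit x.
Proof.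
case=> yx _; apply/eqP => x0; move: yx; rewrite x0 mulr0 => /esym/eqP.
by rewrite oner_eq0.
Qed.
Lemma quat_inv_out : {in [predC quat_unit], quat_inv =1 id}.
Proof.
move=> x; rewrite !inE negbK => /eqP ->.
by congr Quat; rewrite /= ?oppr0 mul0r.
Qed.

HB.instance Definition _ := GRing.NzRing_hasMulInverse.Build (quat R)
  quat_mulVl quat_mulVr quat_unitP quat_inv_out.

End QuatRing.

Definition qmod (R : rcfType) (x : quat R) : R := Num.sqrt (qsqnorm x).

Section AbsoluteSums.
Variables (R : rcfType) (n : nat).
Implicit Types (A : 'M[quat R]_n) (i : 'I_n).

Definition row_abs_sum A i : R := \sum_(j < n) qmod (A i j).
Definition col_abs_sum A i : R := \sum_(j < n) qmod (A j i).

End AbsoluteSums.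

(* The terms of the maximum are nonnegative, so 0 is a neutral default. *)
Definition max_row_col (R : realType) (n : nat) (gamma : R)
    (A : 'M[quat R]_n) : R :=
  \big[Num.max/0]_(i < n)
    (row_abs_sum A i `^ gamma * col_abs_sum A i `^ (1 - gamma)).

Definition reversal (R : realFieldType) (p : {poly quat R})
    (m := (size p).-1) : {poly quat R} :=
  'X^m + \sum_(1 <= j < m) ((p`_0)^-1 * p`_j) *: 'X^(m - j) + ((p`_0)^-1)%:P.

(* Main.v *)
Require Import Defs.
From HB Require Import structures.
From mathcomp Require Import all_boot all_order all_algebra.
From mathcomp Require Import all_classical all_reals all_analysis.
From mathcomp Require Import ring.

(** The two bounds are one statement applied twice. The powers
    [v = (1, z, ..., z^(m-1))] of a zero [z] of a monic polynomial satisfy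
    [C v = v z], where [C] is the companion matrix; no commutation of the
    coefficients with [z] is involved, only that of [z] with its own powers
    ([companionmx_root_powers]). Taking moduli, which are multiplicative and
    subadditive, turns this into a family of inequalities between nonnegative
    reals, [t x_i <= \sum_j a_ij x_j] with [t = |z|], [x_i = |v_i|] and
    [a_ij = |C_ij|].

    Ostrowski's bound then holds for any nonnegative matrix [a] with such a
    nonzero vector [x >= 0] ([subinvariant_le_row_col]). By Hoelder's inequality
    applied to [a_ij = a_ij^gamma a_ij^(1-gamma)],
    [t x_i <= r_i^gamma (\sum_j a_ij x_j^(1/(1-gamma)))^(1-gamma)]. If [t]
    exceeded every [r_i^gamma c_i^(1-gamma)], this would give
    [c_i x_i^(1/(1-gamma)) <= \sum_j a_ij x_j^(1/(1-gamma))] for all [i],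
    strictly for some [i]; but both sides have the same sum over [i]. At
    [gamma = 1], where the exponent degenerates, one reads the inequality at an
    index where [x] is largest.

    This proves the upper bound. Since [p`_0 != 0], the zero [z] is nonzero and
    [z^-1] is a zero of the reversal polynomial ([reversal_rootV]); the upper
    bound for [z^-1] is the lower bound for [z]. *)

Set Implicit Arguments.
Unset Strict Implicit.
Unset Printing Implicit Defensive.

Import Order.TTheory GRing.Theory Num.Theory.
Local Open Scope ring_scope.

(** * Ostrowski's bound for nonnegative matrices *)

(** Hoelder's inequality for the exponents [1 / gamma] and [1 / (1 - gamma)],
    in the form where the weights [w] are shared between the two factors; that
    form also makes sense at [gamma = 0] and [gamma = 1]. *)
Lemma weighted_powR_sum_le (R : realType) (I : finType) (w u : I -> R)
    (gamma : R) :
  (forall i, 0 <= w i) -> (forall i, 0 <= u i) -> 0 <= gamma <= 1 ->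
  \sum_i w i * u i `^ (1 - gamma)
    <= (\sum_i w i) `^ gamma * (\sum_i w i * u i) `^ (1 - gamma).
Proof.
move=> w0 u0 /andP[g0 g1].
have W0 : 0 <= \sum_i w i by exact: sumr_ge0.
have S0 : 0 <= \sum_i w i * u i by apply: sumr_ge0 => i _; exact: mulr_ge0.
have [->|gn0] := eqVneq gamma 0.
  rewrite subr0 powRr0 mul1r powRr1//.
  by under eq_bigr do rewrite powRr1//.
have [->|gn1] := eqVneq gamma 1.
  rewrite subrr powRr0 mulr1 powRr1//.
  by under eq_bigr do rewrite powRr0 mulr1.
have {}g0 : 0 < gamma by rewrite lt0r gn0.
have e0 : 0 < 1 - gamma by rewrite subr_gt0 lt_neqAle gn1.
have [SE|Sn0] := eqVneq (\sum_i w i * u i) 0.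
  rewrite big1 ?mulr_ge0 ?powR_ge0// => i _.
  have /eqP : w i * u i = 0.
    by apply: (psumr_eq0P _ SE) => // j _; exact: mulr_ge0.
  rewrite mulf_eq0 => /orP[/eqP->|/eqP->]; first by rewrite mul0r.
  by rewrite powR0 ?mulr0// gt_eqF.
have Wn0 : \sum_i w i != 0.
  apply: contra_neq Sn0 => WE; apply: big1 => i _.
  by rewrite (psumr_eq0P _ WE) ?mul0r.
have {}W0 : 0 < \sum_i w i by rewrite lt0r Wn0.
have {}S0 : 0 < \sum_i w i * u i by rewrite lt0r Sn0.
set W := \sum_i w i in W0 Wn0 *.
set S := \sum_i w i * u i in S0 Sn0 *.
(* Young's inequality is an equality at [u i = S / W], the weighted mean of
   [u], so summing it at that point loses nothing when [u] is constant. *)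
have y0 : 0 < S / W by exact: divr_gt0.
have young i : u i `^ (1 - gamma) * (S / W) `^ gamma
    <= (1 - gamma) * u i + gamma * (S / W).
  have := @conjugate_powR R (u i `^ (1 - gamma)) ((S / W) `^ gamma)
    (1 - gamma)^-1 gamma^-1.
  rewrite !powR_ge0 !invr_gt0 !invrK subrK -!powRrM !mulfV ?gt_eqF//.
  rewrite !powRr1 ?(ltW y0)// => /(_ erefl erefl e0 g0 erefl).
  by rewrite ![_ * (1 - gamma)]mulrC [_ * gamma]mulrC.
have sum_young : (\sum_i w i * u i `^ (1 - gamma)) * (S / W) `^ gamma <= S.
  rewrite mulr_suml.
  apply: (@le_trans _ _ (\sum_i ((1 - gamma) * (w i * u i)
                                 + gamma * (S / W) * w i))).
    apply: ler_sum => i _; have := ler_wpM2l (w0 i) (young i).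
    by rewrite !mulrA mulrDr; congr (_ <= _); ring.
  rewrite big_split/= -!mulr_sumr -/W -/S.
  have -> : gamma * (S / W) * W = gamma * S by rewrite -mulrA mulfVK.
  by rewrite -mulrDl subrK mul1r.
rewrite -(ler_pM2r (powR_gt0 gamma y0)); apply: le_trans sum_young _.
rewrite [leRHS]mulrAC -powRM ?(ltW W0) ?(ltW y0)//.
rewrite [W * _]mulrC divfK// -powRD ?Sn0 ?implybT// addrC subrK.
by rewrite powRr1 ?(ltW S0).
Qed.

(** For [gamma < 1] the vector is replaced by [u = x^(1/(1-gamma))], the
    exponent for which Hoelder's inequality bounds [t x_i] by the row sum [r_i]
    and by the [i]-th entry [s_i] of the matrix applied to [u]. The columns
    enter through [\sum_i s_i = \sum_j c_j u_j], which is incompatible with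
    [c_i u_i < s_i] at some [i] and [c_i u_i <= s_i] at all the others. *)
Lemma subinvariant_le_row_col (R : realType) (I : finType) (a : I -> I -> R)
    (x : I -> R) (t gamma : R) (i0 : I) :
  (forall i j, 0 <= a i j) -> (forall i, 0 <= x i) -> x i0 != 0 ->
  (forall i, t * x i <= \sum_j a i j * x j) -> 0 <= gamma <= 1 ->
  exists i, t <= (\sum_j a i j) `^ gamma * (\sum_j a j i) `^ (1 - gamma).
Proof.
move=> a0 x0 xi0 tx /andP[g0 g1].
have r0 i : 0 <= \sum_j a i j by exact: sumr_ge0.
have c0 i : 0 <= \sum_j a j i by exact: sumr_ge0.
have [->|gn1] := eqVneq gamma 1.
  case: (@arg_maxP _ _ _ i0 predT x erefl) => i _ xi.
  exists i; rewrite subrr powRr0 mulr1 powRr1//.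
  have xip : 0 < x i by apply: lt_le_trans (xi i0 erefl); rewrite lt0r xi0 x0.
  rewrite -(ler_pM2r xip) (le_trans (tx i))// mulr_suml.
  by apply: ler_sum => j _; apply: ler_wpM2l => //; exact: xi.
have e0 : 0 < 1 - gamma by rewrite subr_gt0 lt_neqAle gn1.
pose u i := x i `^ (1 - gamma)^-1.
have u0 i : 0 <= u i by exact: powR_ge0.
have ux i : u i `^ (1 - gamma) = x i.
  by rewrite -powRrM mulVf ?gt_eqF// powRr1.
apply/existsP; apply: contraT; rewrite negb_exists => /forallP tgt.
pose s i := \sum_j a i j * u j.
have s0 i : 0 <= s i by apply: sumr_ge0 => j _; exact: mulr_ge0.
have txs i : t * x i <= (\sum_j a i j) `^ gamma * s i `^ (1 - gamma).
  apply: le_trans (tx i) _; under eq_bigr do rewrite -ux.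
  by apply: weighted_powR_sum_le => //; rewrite g0.
have cus i : x i != 0 -> (\sum_j a j i) * u i < s i.
  move=> xin0; have xip : 0 < x i by rewrite lt0r xin0 x0.
  (* Were [s_i <= c_i u_i], then [t x_i <= r_i^gamma s_i^(1-gamma)
     <= r_i^gamma c_i^(1-gamma) x_i < t x_i]. *)
  have := tgt i; rewrite -ltNge => lt_t; rewrite ltNge; apply/negP => scu.
  rewrite -(ltr_pM2r xip) in lt_t.
  have := lt_le_trans lt_t (txs i); rewrite -mulrA -{1}[x i]ux -powRM//.
  rewrite ltNge ler_wpM2l ?powR_ge0//.
  by apply: ge0_ler_powR; rewrite ?nnegrE ?mulr_ge0// ltW.
have : \sum_i (\sum_j a j i) * u i < \sum_i s i.
  rewrite (bigD1 i0)//= [ltRHS](bigD1 i0)//=; apply: ltr_leD; first exact: cus.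
  apply: ler_sum => i _; have [xi|xi] := eqVneq (x i) 0; last exact/ltW/cus.
  by rewrite /u xi powR0 ?mulr0// invr_eq0 gt_eqF.
rewrite /s exchange_big/=; under [X in _ < X]eq_bigr do rewrite -mulr_suml.
by rewrite ltxx.
Qed.

(** * The modulus of quaternions *)

Lemma quat_unitE (R : realFieldType) (x : quat R) :
  (x \is a GRing.unit) = (x != 0).
Proof. by []. Qed.

Section QuatModulus.
Variable R : rcfType.
Implicit Types x y : quat R.

Lemma qsqnorm_ge0 x : 0 <= qsqnorm x.
Proof. by rewrite /qsqnorm !addr_ge0 ?sqr_ge0. Qed.

Lemma qmod_ge0 x : 0 <= qmod x.
Proof. exact: sqrtr_ge0. Qed.

Lemma qmod_eq0 x : (qmod x == 0) = (x == 0).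
Proof. by rewrite sqrtr_eq0 le_eqVlt ltNge qsqnorm_ge0 orbF qsqnorm_eq0. Qed.

Lemma qmodM x y : qmod (x * y) = qmod x * qmod y.
Proof.
rewrite /qmod -sqrtrM ?qsqnorm_ge0//; congr Num.sqrt.
by case: x y => [a b c d] [a' b' c' d']; rewrite /qsqnorm/=; ring.
Qed.

Lemma qmod0 : qmod (0 : quat R) = 0.
Proof. by apply/eqP; rewrite qmod_eq0. Qed.

Lemma qmod1 : qmod (1 : quat R) = 1.
Proof. by rewrite /qmod /qsqnorm/= expr1n !expr0n/= !addr0 sqrtr1. Qed.

Lemma qmodV x : x != 0 -> qmod x^-1 = (qmod x)^-1.
Proof.
move=> x0; have mx0 : qmod x != 0 by rewrite qmod_eq0.
by apply: (mulIf mx0); rewrite mulVf// -qmodM mulVr ?qmod1.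
Qed.

Lemma ler_qmodD x y : qmod (x + y) <= qmod x + qmod y.
Proof.
have xy0 : 0 <= qmod x + qmod y by rewrite addr_ge0 ?qmod_ge0.
rewrite -(ler_pXn2r (ltn0Sn 1)) ?nnegrE ?qmod_ge0// sqrrD.
rewrite {1 2 4}/qmod !sqr_sqrtr ?qsqnorm_ge0//.
(* Cauchy-Schwarz for the inner product of [R^4], from Lagrange's identity. *)
pose ip := qre x * qre y + qi x * qi y + qj x * qj y + qk x * qk y.
have -> : qsqnorm (x + y) = qsqnorm x + ip *+ 2 + qsqnorm y.
  by rewrite /qsqnorm /ip/=; ring.
rewrite lerD2r lerD2l lerMn2r/= /qmod -sqrtrM ?qsqnorm_ge0//.
apply: le_trans (ler_norm _) _; rewrite -sqrtr_sqr; apply: ler_wsqrtr.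
rewrite -subr_ge0.
have -> : qsqnorm x * qsqnorm y - ip ^+ 2 =
    (qre x * qi y - qi x * qre y) ^+ 2 + (qre x * qj y - qj x * qre y) ^+ 2
  + (qre x * qk y - qk x * qre y) ^+ 2 + (qi x * qj y - qj x * qi y) ^+ 2
  + (qi x * qk y - qk x * qi y) ^+ 2 + (qj x * qk y - qk x * qj y) ^+ 2.
  by rewrite /qsqnorm /ip; ring.
by rewrite !addr_ge0 ?sqr_ge0.
Qed.

Lemma ler_qmod_sum (I : finType) (f : I -> quat R) :
  qmod (\sum_i f i) <= \sum_i qmod (f i).
Proof.
elim/big_ind2: _ => [|x1 a1 x2 a2 le1 le2|//]; first by rewrite qmod0.
exact: le_trans (ler_qmodD _ _) (lerD le1 le2).
Qed.

End QuatModulus.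

(** * Right eigenvalues and zeros of monic polynomials *)

(** The eigenvalue is on the right because this is the side on which a
    quaternionic matrix is linear; the modulus forgets the side, being
    multiplicative with values in a commutative field. *)
Lemma qmod_right_eigenvalue_le (R : realType) (n : nat) (A : 'M[quat R]_n)
    (v : 'I_n -> quat R) (z : quat R) (gamma : R) (i0 : 'I_n) :
  v i0 != 0 -> (forall i, \sum_j A i j * v j = v i * z) -> 0 <= gamma <= 1 ->
  qmod z <= max_row_col gamma A.
Proof.
move=> vi0 Av g01.
have [||||i] := @subinvariant_le_row_col R 'I_n (fun i j => qmod (A i j))
  (fun i => qmod (v i)) (qmod z) gamma i0 _ _ _ _ g01.
- by move=> i j; exact: qmod_ge0.
- by move=> i; exact: qmod_ge0.
- by rewrite qmod_eq0.
- move=> i; rewrite mulrC -qmodM -Av; apply: le_trans (ler_qmod_sum _) _.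
  by apply: ler_sum => j _; rewrite qmodM.
move=> /le_trans; apply; exact: le_bigmax.
Qed.

(** All rows but the last shift the exponent by one; the last row says that
    [z^m] is minus the lower part of [p.[z]], that is [p.[z] = 0]. *)
Lemma companionmx_root_powers (F : nzRingType) (p : {poly F}) (z : F) :
  p \is monic -> p.[z] = 0 -> forall i : 'I_(size p).-1,
  \sum_j companionmx p i j * z ^+ j = z ^+ i * z.
Proof.
move=> p_monic pz i; rewrite -exprSr.
have [m size_p] : exists m, size p = m.+2.
  by case: (size p) i => [|[|m]] i; [case: i|case: i|exists m].
under eq_bigr do rewrite mxE.
have [iE|iN] := eqVneq (i : nat) (size p).-1.-1.
  have lead : p`_(size p).-1 = 1 by apply/eqP; rewrite -monicE.
  move: pz; rewrite horner_coef.
  under eq_bigr do rewrite mulNr.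
  rewrite sumrN iE; rewrite size_p/= in lead *.
  rewrite big_ord_recr/= lead mul1r => /eqP; rewrite addr_eq0 => /eqP ->.
  by rewrite opprK.
have ip : (i.+1 < (size p).-1)%N.
  move: iN (ltn_ord i); move: (nat_of_ord i) => k; rewrite size_p/= => kN.
  by rewrite !ltnS leq_eqVlt (negPf kN).
rewrite (bigD1 (Ordinal ip))//= eqxx mul1r big1 ?addr0// => j.
by rewrite -val_eqE/= eq_sym => /negPf ->; rewrite mul0r.
Qed.

Lemma qmod_root_le_max_row_col (R : realType) (p : {poly quat R}) (z : quat R)
    (gamma : R) :
  p \is monic -> p.[z] = 0 -> 0 <= gamma <= 1 ->
  qmod z <= max_row_col gamma (companionmx p).
Proof.
move=> p_monic pz g01.
have d_gt0 : (0 < (size p).-1)%N.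
  rewrite lt0n; apply/eqP => d0; move: pz.
  have /size1_polyC pE : (size p <= 1)%N by rewrite -subn_eq0 subn1 d0.
  have := monicP p_monic; rewrite pE lead_coefC hornerC => -> /eqP.
  by rewrite oner_eq0.
apply: (@qmod_right_eigenvalue_le _ _ _ (fun i => z ^+ i) z gamma
  (Ordinal d_gt0)).
- by rewrite expr0 oner_eq0.
- exact: companionmx_root_powers.
- exact: g01.
Qed.

(** * The reversal polynomial *)

(** The reversal lists the coefficients of [p] backwards, scaled on the left by
    [(p`_0)^-1]. Its two outer terms are the cases [i = m], where
    [(p`_0)^-1 * p`_0 = 1], and [i = 0], where [p`_m = 1]. *)
Lemma reversal_poly (R : realFieldType) (p : {poly quat R})
    (m := (size p).-1) : (0 < m)%N -> p \is monic -> p`_0 != 0 ->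
  reversal p = \poly_(i < m.+1) ((p`_0)^-1 * p`_(m - i)).
Proof.
move=> m_gt0 p_monic p0.
have lead : p`_m = 1 by apply/eqP; rewrite -monicE.
rewrite poly_def -(big_mkord predT (fun i => ((p`_0)^-1 * p`_(m - i)) *: 'X^i)).
rewrite big_nat_rev/= add0n big_ltn// big_nat_recr//= !subSS subn0 subnn.
rewrite mulVr ?quat_unitE// scale1r subn0 lead mulr1 expr0 alg_polyC addrA.
rewrite /reversal.
congr (_ + _ + _); apply: eq_big_nat => i /andP[_ im].
by rewrite subSS subKn// ltnW.
Qed.

Lemma reversal_monic (R : realFieldType) (p : {poly quat R}) :
  (1 < size p)%N -> p \is monic -> p`_0 != 0 -> reversal p \is monic.
Proof.
move=> p_gt1 p_monic p0.
have d_gt0 : (0 < (size p).-1)%N by rewrite -subn1 subn_gt0.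
rewrite (reversal_poly d_gt0 p_monic p0).
set E := fun i => _.
have E1 : E (size p).-1 = 1 by rewrite /E subnn mulVr ?quat_unitE.
apply/monicP; rewrite -E1; apply: lead_coef_poly; first exact: ltn0Sn.
by rewrite -[X in X != 0]/(E (size p).-1) E1; exact: quat_one_neq0.
Qed.

(** [q.[z^-1] * z^m = (p`_0)^-1 * p.[z]] for the reversal [q]: powers of [z] are
    multiplied on the right, so they never have to cross a coefficient. *)
Lemma reversal_rootV (R : realFieldType) (p : {poly quat R}) (z : quat R) :
  (1 < size p)%N -> p \is monic -> p`_0 != 0 -> z != 0 -> p.[z] = 0 ->
  (reversal p).[z^-1] = 0.
Proof.
move=> p_gt1 p_monic p0 z0 pz.
have uz : z \is a GRing.unit by rewrite quat_unitE.
have d_gt0 : (0 < (size p).-1)%N by rewrite -subn1 subn_gt0.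
rewrite (reversal_poly d_gt0 p_monic p0).
rewrite horner_poly prednK; last exact: ltnW.
apply: (mulIr (unitrX (size p).-1 uz)); rewrite mul0r mulr_suml.
transitivity ((p`_0)^-1 * p.[z]); last by rewrite pz mulr0.
rewrite (reindex_inj rev_ord_inj)/= horner_coef mulr_sumr.
apply: eq_bigr => i _.
have im : (i <= (size p).-1)%N by rewrite -ltnS prednK// ltnW.
have -> : (size p - i.+1 = (size p).-1 - i)%N by rewrite -subn1 -subnDA.
rewrite subKn// -!mulrA; do 2!congr (_ * _).
by rewrite -{2}(subnK im) exprD mulrA -exprMn_comm ?mulVr ?expr1n ?mul1r//
  /GRing.comm mulVr// mulrV.
Qed.

(* [p.[z]] is the sum of p`_j * z ^+ j, with the coefficients on the left, and
   [companionmx p] is a square matrix of size (size p).-1 = m. *)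
Theorem theorem4p3 (R : realType) (m : nat) (p : {poly quat R})
    (m_gt0 : (0 < m)%N) (p_monic : p \is monic) (size_p : size p = m.+1)
    (p0_neq0 : p`_0 != 0) (z : quat R) (pz0 : p.[z] = 0)
    (gamma : R) (gamma_ge0 : 0 <= gamma) (gamma_le1 : gamma <= 1) :
  (max_row_col gamma (companionmx (reversal p)))^-1 <= qmod z
    <= max_row_col gamma (companionmx p).
Proof.
have g01 : 0 <= gamma <= 1 by rewrite gamma_ge0.
have p_gt1 : (1 < size p)%N by rewrite size_p ltnS.
rewrite qmod_root_le_max_row_col// andbT.
have z0 : z != 0.
  apply: contra_neq p0_neq0 => z0.
  by rewrite -horner_coef0; move: pz0; rewrite z0.
have mz0 : 0 < (qmod z)^-1 by rewrite invr_gt0 lt0r qmod_eq0 z0 qmod_ge0.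
have le_zV : (qmod z)^-1 <= max_row_col gamma (companionmx (reversal p)).
  rewrite -(qmodV z0); apply: qmod_root_le_max_row_col g01.
    exact: reversal_monic p_gt1 p_monic p0_neq0.
  exact: reversal_rootV p_gt1 p_monic p0_neq0 z0 pz0.
by rewrite -[leRHS]invrK lef_pV2// posrE (lt_le_trans mz0).
Qed.
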